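(* Let $G$ be a compact abelian group with dual group $\Gamma$, let $1<p\le 2$, and let $a>0$ be a constant for which the contraction principle for the $p$-stable norm (stated in the context) holds. Let $f,f_1,\dots,f_N$ be trigonometric polynomials on $G$ such that $$|\hat f(\gamma)|\ge\Big(\sum_{j=1}^N|\hat f_j(\gamma)|^p\Big)^{1/p},\qquad\forall\gamma\in\Gamma.$$ Then $$[\![f]\!]_p\ge a^{-1}\Big(\sum_{j=1}^N[\![f_j]\!]_p^p\Big)^{1/p}.$$
   Context: $G$ carries its normalized Haar measure; elements of the discrete dual $\Gamma$ are viewed as characters on $G$. Trigonometric polynomials are finite sums $\sum_{\gamma\in\Gamma}c_\gamma\gamma$ with complex coefficients. A complex symmetric $p$-stable random variable $Z$ is one with $\mathbb E(e^{i\,\mathrm{Re}(\bar zZ)})=\exp(-|z|^p)$ for all $z\in\mathbb C$ ($p=2$ is the Gaussian case). For a trigonometric polynomial $f$, $[\![f]\!]_p=\mathbb E\big\|\sum_\gamma Z_\gamma\hat f(\gamma)\gamma\big\|_\infty$, where $(Z_\gamma)_{\gamma\in\Gamma}$ are independent copies of a complex symmetric $p$-stable random variable. Contraction principle for the $p$-stable norm with constant $a$: for every trigonometric polynomial $f$ and every collection $(\xi_\gamma)_{\gamma\in\Gamma}$ of functions bounded in $L^p(0,1)$, $$\Big(\int_0^1\Big[\!\!\Big[\sum_{\gamma}\xi_\gamma(\omega')\hat f(\gamma)\gamma\Big]\!\!\Big]_p^p\,d\omega'\Big)^{1/p}\le a\,\sup_{\gamma}\|\xi_\gamma\|_{L^p(0,1)}\,[\![f]\!]_p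 .$$ Such a constant $a$ exists. *)

(* Defs.v *)
From HB Require Import structures.
From mathcomp Require Import all_boot all_order all_algebra finmap complex.
From mathcomp Require Import all_classical all_reals all_analysis.

Set Implicit Arguments.
Unset Strict Implicit.
Unset Printing Implicit Defensive.

Import Order.TTheory GRing.Theory Num.Theory.
Import numFieldNormedType.Exports.

Local Open Scope classical_set_scope.
Local Open Scope ring_scope.

(* The library has no sigma-algebra on R[i]: the Borel sets of R[i] are those
   of R * R through this bijection. *)
Definition cpair (R : realType) (z : R[i]) : R * R := (complex.Re z, complex.Im z).

Definition cmeasurable_fun d (T : measurableType d) (R : realType)
    (D : set T) (f : T -> R[i]) : Prop :=
  measurable_fun D (fun t => cpair (f t)).

(* Only applied below to bounded measurable functions and finite measures. *)
Definition cintegral d (T : measurableType d) (R : realType)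
    (m : {measure set T -> \bar R}) (f : T -> R[i]) : R[i] :=
  Complex (\int[m]_t complex.Re (f t)) (\int[m]_t complex.Im (f t)).

(* The cast to zmodType supplies the base point 0 that measurable types need. *)
Definition borelType (G : topologicalZmodType) : Type :=
  g_sigma_algebraType (@open G : set (set (G : zmodType))).

HB.instance Definition _ (G : topologicalZmodType) :=
  Measurable.on (borelType G).

Definition is_haar (R : realType) (G : topologicalZmodType)
    (mu : probability (borelType G) R) : Prop :=
  [/\ forall (x : G) (A : set (borelType G)), measurable A ->
        mu [set x + y | y in (A : set G)] = mu A,
      forall A : set (borelType G), measurable A ->
        mu A = ereal_inf [set mu U | U in [set U : set G | open U /\ A `<=` U]]
    & forall U : set G, open U ->
        mu U = ereal_sup [set mu K | K in [set K : set G | compact K /\ K `<=` U]]].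

Record dual (R : realType) (G : topologicalZmodType) := Character {
  character_fun :> G -> R[i] ;
  character_continuous : continuous (character_fun : G -> R[i]^o) ;
  characterD : forall x y : G,
    character_fun (x + y) = character_fun x * character_fun y ;
  character_norm1 : forall x : G, `|character_fun x| = 1 }.

HB.instance Definition _ (R : realType) (G : topologicalZmodType) :=
  gen_eqMixin (dual R G).
HB.instance Definition _ (R : realType) (G : topologicalZmodType) :=
  gen_choiceMixin (dual R G).

Definition trigpoly (R : realType) (G : topologicalZmodType) (f : G -> R[i]) :
    Prop :=
  exists (s : {fset dual R G}) (c : dual R G -> R[i]),
    forall x, f x = \sum_(g <- s) c g * g x.

Definition fourier (R : realType) (G : topologicalZmodType)
    (mu : probability (borelType G) R) (f : G -> R[i]) (g : dual R G) : R[i] :=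
  cintegral mu (fun x : borelType G => f x * conjc (g x)).

Definition supnorm (R : realType) (G : Type) (f : G -> R[i]) : \bar R :=
  ereal_sup (range (fun x => (Normc.normc (f x))%:E)).

Definition pstable d (Omega : measurableType d) (R : realType)
    (P : probability Omega R) (p : R) (Z : Omega -> R[i]) : Prop :=
  cmeasurable_fun setT Z /\
  forall z : R[i],
    cintegral P (fun w => let t := complex.Re (conjc z * Z w) in
                          Complex (cos t) (sin t)) =
    Complex (expR (- (Normc.normc z `^ p))) 0.

Definition identically_distributed d (Omega : measurableType d) (R : realType)
    (P : probability Omega R) (I : Type) (Z : I -> Omega -> R[i]) : Prop :=
  forall (i j : I) (A : set (R * R)), measurable A ->
    P ((cpair (R := R) \o Z i) @^-1` A) = P ((cpair (R := R) \o Z j) @^-1` A).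

Definition mutually_independent d (Omega : measurableType d) (R : realType)
    (P : probability Omega R) (I : choiceType) (Z : I -> Omega -> R[i]) : Prop :=
  forall (s : {fset I}) (A : I -> set (R * R)), (forall i, measurable (A i)) ->
    P (\bigcap_(i in [set` s]) ((cpair (R := R) \o Z i) @^-1` A i)) =
    (\prod_(i <- s) P ((cpair (R := R) \o Z i) @^-1` A i))%E.

Definition iid_pstable d (Omega : measurableType d) (R : realType)
    (P : probability Omega R) (p : R) (I : choiceType) (Z : I -> Omega -> R[i]) :
    Prop :=
  [/\ forall i, pstable P p (Z i), identically_distributed P Z
    & mutually_independent P Z].

(* The exponent p enters only through the law of the Z g.  For a trigonometric
   polynomial f, the sum over the dual has finite support. *)
Definition pstable_norm d (Omega : measurableType d) (R : realType)
    (P : probability Omega R) (G : topologicalZmodType)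
    (mu : probability (borelType G) R) (Z : dual R G -> Omega -> R[i])
    (f : G -> R[i]) : \bar R :=
  (\int[P]_w supnorm (fun x : G =>
     \sum_(g \in [set: dual R G]) Z g w * fourier mu f g * g x)%R)%E.

Definition Lp01_norm (R : realType) (p : R) (xi : R -> R[i]) : \bar R :=
  ((\int[lebesgue_measure]_(t in `]0%R, 1%R[) (Normc.normc (xi t) `^ p)%:E)
     `^ p^-1)%E.

Definition contraction_principle d (Omega : measurableType d) (R : realType)
    (P : probability Omega R) (G : topologicalZmodType)
    (mu : probability (borelType G) R) (Z : dual R G -> Omega -> R[i])
    (p a : R) : Prop :=
  forall (f : G -> R[i]) (xi : dual R G -> R -> R[i]),
    trigpoly f ->
    (forall g, cmeasurable_fun (`]0, 1[ : set (measurableTypeR R)) (xi g)) ->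
    (ereal_sup (range (fun g => Lp01_norm p (xi g))) < +oo)%E ->
    ((\int[lebesgue_measure]_(t in `]0%R, 1%R[)
        pstable_norm P mu Z (fun x : G =>
          \sum_(g \in [set: dual R G]) xi g t * fourier mu f g * g x)%R `^ p)
       `^ p^-1
     <= a%:E * ereal_sup (range (fun g => Lp01_norm p (xi g)))
        * pstable_norm P mu Z f)%E.

(* Main.v *)
Require Import Defs.
From mathcomp Require Import all_boot all_order all_algebra finmap complex.
From mathcomp Require Import all_classical all_reals all_analysis.
From mathcomp Require Import measurable_realfun.

Import Order.TTheory GRing.Theory Num.Theory.
Import numFieldNormedType.Exports.

Local Open Scope classical_set_scope.
Local Open Scope ring_scope.

(** Cut ]0, 1[ into N slots of length 1/N and apply the contraction principle
to f with the multipliers xi_g equal to N^(1/p) fs_j^(g) / f^(g) on slot j.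

The p-th power of the L^p norm of xi_g is the average over the slots of
N |fs_j^(g)|^p / |f^(g)|^p, that is the sum over j of |fs_j^(g)|^p / |f^(g)|^p;
the domination hypothesis says precisely that this is at most 1.  On slot j the
multiplied polynomial has the Fourier coefficients N^(1/p) fs_j^(g), also where
f^(g) vanishes, since domination then forces fs_j^(g) = 0.  So its p-stable norm
is at least N^(1/p) times that of fs_j, and the average over the slots of its
p-th power is at least the sum of the p-th powers of the norms of the fs_j: the
contraction inequality becomes the theorem.

Reading off the Fourier coefficients of a multiplied polynomial requires the
orthonormality of characters ([fourier_dual], [fourier_fsbig]), which comes
from the invariance of the Haar measure: if chi(y) <> 1, then translating by y
gives I = chi(y) I for the integral I of chi, so I = 0
([cintegral_morphism0]).

The homogeneity of the p-stable norm appears as an inequality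
([pstable_normZ]).  The integrand is a supremum over the possibly uncountable
group G, whose measurability would take an argument of its own; the inequality
follows from the definition of the integral as a supremum over simple functions
([ge0_integral_scale_le]). *)

(** * Integration over equal slots of the unit interval *)

(** Multiplying by c maps the simple functions below h1 to simple functions
below h2, and the integral of any nonnegative function is the supremum of the
integrals of the simple functions below it. *)
Lemma ge0_integral_scale_le d (T : measurableType d) (R : realType)
    (m : {measure set T -> \bar R}) (c : R) (h1 h2 : T -> \bar R) :
  0 < c -> (forall x, 0 <= h1 x)%E -> (forall x, c%:E * h1 x <= h2 x)%E ->
  (c%:E * \int[m]_x h1 x <= \int[m]_x h2 x)%E.
Proof.
move=> c0 h10 h12; have cs0 : 0 <= c by exact: ltW.
have h20 x : (0 <= h2 x)%E by apply: le_trans (h12 x); rewrite mule_ge0.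
rewrite !ge0_integralTE// -lee_pdivlMl//.
apply: ge_ereal_sup => _ [s sh <-]; rewrite lee_pdivlMl//.
rewrite -sintegralrM; apply: ereal_sup_ubound.
exists (scale_nnsfun s cs0) => // x; apply: le_trans (h12 x).
by rewrite /= EFinM lee_pmul2l.
Qed.

(** Closed on the left, except that slot 0 leaves out 0: the slots j < N then
partition exactly the open interval over which the contraction principle
integrates. *)
Definition slot (R : realType) (N j : nat) : set R :=
  [set` Interval (BSide (j != 0%N) (j%:R / N%:R)) (BLeft (j.+1%:R / N%:R))].

Lemma slotP (R : realType) (N j : nat) (t : R) : (0 < N)%N ->
  slot R N j t <-> 0 < t /\ j%:R <= t * N%:R < j.+1%:R.
Proof.
move=> N0; have N0' : 0 < N%:R :> R by rewrite ltr0n.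
rewrite /slot /= in_itv /= ltr_pdivlMr//.
case: j => [|j] /=.
  rewrite mul0r; split=> [/andP[t0 ->]|[-> /andP[_ ->]]//].
  by rewrite t0 mulr_ge0 ?ltW.
rewrite ler_pdivrMr//; split=> [/andP[jt ->]|[_ ->]//]; rewrite jt; split=> //.
by rewrite -(pmulr_lgt0 t N0') (lt_le_trans _ jt)// ltr0n.
Qed.

(** The index of the slot of t is the integer part of N t. *)
Lemma slot_disjoint {R : realType} {N i j : nat} {t : R} : (0 < N)%N ->
  slot R N i t -> slot R N j t -> i = j.
Proof.
move=> N0 /(slotP _ _ _ _ N0)[_ ti] /(slotP _ _ _ _ N0)[_ tj].
by rewrite -(truncn_def ti) -(truncn_def tj).
Qed.

Lemma slot_cover (R : realType) (N : nat) : (0 < N)%N ->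
  (`]0, 1[ : set R)%classic = \big[setU/set0]_(j < N) slot R N j.
Proof.
move=> N0; have N0' : 0 < N%:R :> R by rewrite ltr0n.
rewrite -bigcup_mkord; apply/seteqP; split => [t|t [j /= jN]].
  rewrite /= in_itv /= => /andP[t0 t1].
  have tN0 : 0 <= t * N%:R by rewrite mulr_ge0 ?ltW.
  have /andP[jt tj] := truncn_itv tN0.
  exists (Num.truncn (t * N%:R)); last by apply/slotP => //; rewrite jt tj.
  by rewrite /= -(ltr_nat R) (le_lt_trans jt)// gtr_pMl.
move=> /(slotP _ _ _ _ N0)[t0 /andP[_ tj]]; rewrite /= in_itv /= t0 /=.
by rewrite -(ltr_pM2r N0') mul1r (lt_le_trans tj)// ler_nat.
Qed.

Lemma measurable_slot (R : realType) (N j : nat) :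
  measurable (slot R N j : set (measurableTypeR R)).
Proof. exact: measurable_itv. Qed.

Lemma lebesgue_slot (R : realType) (N j : nat) : (0 < N)%N ->
  lebesgue_measure (slot R N j) = (N%:R^-1)%:E :> \bar R.
Proof.
move=> N0; have N0' : 0 < N%:R :> R by rewrite ltr0n.
rewrite /slot lebesgue_measure_itv /= lte_fin ltr_pM2r ?invr_gt0//.
by rewrite ltr_nat ltnSn -EFinB -mulrBl -natrB// subSnn mul1r.
Qed.

(** The values F j may be infinite, as p-stable norms are not known to be finite
here. *)
Lemma integral_slots (R : realType) (N : nat) (F : 'I_N -> \bar R)
    (h : R -> \bar R) : (0 < N)%N -> (forall j, 0 <= F j)%E ->
  (forall (j : 'I_N) t, slot R N j t -> h t = F j) ->
  (\int[lebesgue_measure]_(t in `]0%R, 1%R[) h t =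
   \sum_(j < N) (N%:R^-1)%:E * F j)%E.
Proof.
move=> N0 F0 hF; rewrite (slot_cover R N N0).
(* Measurability of the union is carried along: gluing measurable functions
   needs measurable pieces. *)
have mh : measurable (\big[setU/set0]_(j < N) slot R N j) /\
    measurable_fun (\big[setU/set0]_(j < N) slot R N j) h.
  elim/big_ind: _ => [|A B [mA hA] [mB hB]|j _].
  - by split; [exact: measurable0|exact: measurable_fun_set0].
  - by split; [exact: measurableU|apply/measurable_funU].
  - split; first exact: measurable_slot.
    apply: (eq_measurable_fun (cst (F j))); last exact: measurable_cst.
    by move=> t /set_mem /hF.
rewrite ge0_integral_bigsetU.
- apply: eq_bigr => j _.
  rewrite (eq_integral (cst (F j))); last by move=> t /set_mem /hF.
  rewrite integral_cst; last exact: measurable_slot.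
  by rewrite muleC; congr (_ * _)%E; exact: lebesgue_slot.
- by move=> j; exact: measurable_slot.
- exact: index_enum_uniq.
- move=> i j _ _ [t [ti tj]].
  exact/val_inj/(slot_disjoint N0 ti tj).
- exact: mh.2.
- by move=> t; rewrite -bigcup_mkord => -[j jN /(hF (Ordinal jN))->].
Qed.

Definition step (R : realType) (N : nat) (v : 'I_N -> R[i]) (t : R) : R[i] :=
  \sum_(j < N) (\1_(slot R N j) t)%:C%C * v j.

Lemma step_slot (R : realType) (N : nat) (v : 'I_N -> R[i]) (j : 'I_N) (t : R) :
  (0 < N)%N -> slot R N j t -> step R N v t = v j.
Proof.
move=> N0 jt; rewrite /step (bigD1 j)//= big1 => [|i ij].
  by rewrite addr0 indicE mem_set// mul1r.
rewrite indicE memNset ?mul0r// => it.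
by move/eqP: ij; apply; exact/val_inj/(slot_disjoint N0 it jt).
Qed.

Lemma Re_sum (R : realType) (I : Type) (s : seq I) (F : I -> R[i]) :
  complex.Re (\sum_(i <- s) F i) = \sum_(i <- s) complex.Re (F i).
Proof.
apply: (big_ind2 (fun z x => complex.Re z = x)) => // z1 x1 z2 x2 <- <-.
by case: z1 z2 => [? ?] [].
Qed.

Lemma Im_sum (R : realType) (I : Type) (s : seq I) (F : I -> R[i]) :
  complex.Im (\sum_(i <- s) F i) = \sum_(i <- s) complex.Im (F i).
Proof.
apply: (big_ind2 (fun z x => complex.Im z = x)) => // z1 x1 z2 x2 <- <-.
by case: z1 z2 => [? ?] [].
Qed.

Lemma cmeasurable_step (R : realType) (N : nat) (v : 'I_N -> R[i])
    (D : set (measurableTypeR R)) : cmeasurable_fun D (step R N v).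
Proof.
apply: measurable_funTS; apply: measurable_fun_pair.
- rewrite /step; under eq_fun do rewrite Re_sum.
  apply: measurable_sum => j.
  rewrite (_ : (fun _ => _) = (fun t => \1_(slot R N j) t * complex.Re (v j))).
    by apply: measurable_funM => //; apply: measurable_indic; exact: measurable_slot.
  by apply/funext => t; case: (v j) => x y /=; rewrite mul0r subr0.
- rewrite /step; under eq_fun do rewrite Im_sum.
  apply: measurable_sum => j.
  rewrite (_ : (fun _ => _) = (fun t => \1_(slot R N j) t * complex.Im (v j))).
    by apply: measurable_funM => //; apply: measurable_indic; exact: measurable_slot.
  by apply/funext => t; case: (v j) => x y /=; rewrite mul0r addr0.
Qed.

(** * Haar integration and orthonormality of characters *)

Section HaarIntegral.
Context (R : realType) (G : topologicalZmodType)
  (mu : probability (borelType G) R) (haar_mu : is_haar mu).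

Lemma measurable_borel (h : G -> R) : continuous h ->
  measurable_fun [set: borelType G] (h : borelType G -> R).
Proof.
move=> /continuousP ch; apply: (measurability _ (RGenOpens.measurableE R)).
move=> _ [_ [a [b ->] <-]]; rewrite setTI; apply: sub_sigma_algebra.
exact/ch/interval_open.
Qed.

Lemma continuous_shift (y : G) : continuous (fun x : G => y + x).
Proof.
move=> x; apply: (@continuous_comp G (G * G)%type G (fun x => (y, x))
  (fun z : G * G => z.1 + z.2)); last exact: add_continuous.
by apply: cvg_pair; [exact: cvg_cst|exact: cvg_id].
Qed.

Lemma measurable_shift (y : G) :
  measurable_fun [set: borelType G] (fun x : borelType G => (y + x : borelType G)).
Proof.
apply: (@measurability _ _ (borelType G) (borelType G) setT _ (@open G : set (set (G : zmodType))) erefl).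
move=> _ [A oA <-]; rewrite setTI; apply: sub_sigma_algebra.
by move: (continuous_shift y) => /continuousP; apply.
Qed.

Lemma integrable_borel (h : G -> R) (M : R) : continuous h ->
  (forall x, `|h x| <= M) -> mu.-integrable setT (EFin \o (h : borelType G -> R)).
Proof.
move=> ch hM; apply: measurable_bounded_integrable => //.
- exact: fin_num_fun_lty.
- exact: measurable_borel.
- exists M; split; first exact: num_real.
  by move=> x Mx y _; apply: le_trans (hM y) (ltW Mx).
Qed.

(** Invariance of mu says that mu is its own image under translation by y. *)
Lemma Rintegral_shift (h : G -> R) (M : R) (y : G) : continuous h ->
  (forall x, `|h x| <= M) ->
  \int[mu]_(x in setT) h (y + x) = \int[mu]_(x in setT) h x.
Proof.
move=> ch hM; congr fine.
have mh : measurable_fun [set: borelType G] (EFin \o (h : borelType G -> R)).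
  by apply/measurable_EFinP; exact: measurable_borel.
have ih : mu.-integrable ((fun x : borelType G => y + x : borelType G) @^-1` setT)
    ((EFin \o (h : borelType G -> R)) \o (fun x : borelType G => y + x)).
  rewrite preimage_setT; apply: (integrable_borel (fun x => h (y + x)) M) => // x.
  exact: (continuous_comp (continuous_shift y x) (ch (y + x))).
have /= := integral_pushforward (measurable_shift y) mh ih measurableT.
rewrite preimage_setT => <-. apply: eq_measure_integral; first exact: measurable_shift.
move=> ? A mA _.
case: haar_mu => muD _ _; refine (etrans _ (muD (- y) A mA)).
congr (mu _); apply/seteqP; split => [x Ayx|_ [x Ax <-]] /=.
  by exists (y + x) => //; rewrite addKr.
by rewrite addNKr.
Qed.

(** Continuity into R[i], in the coordinates on which [cintegral] is defined. *)
Definition ccontinuous (F : G -> R[i]) :=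
  continuous (fun x => complex.Re (F x)) /\ continuous (fun x => complex.Im (F x)).

Lemma Re_le_normc (z : R[i]) : `|complex.Re z| <= Normc.normc z.
Proof. by have := normc_ge_Re z; rewrite lecE => /andP[]. Qed.

Lemma Im_le_normc (z : R[i]) : `|complex.Im z| <= Normc.normc z.
Proof.
case: z => x y /=; rewrite -(sqrtr_sqr y) ler_wsqrtr// lerDr sqr_ge0 //.
Qed.

Definition cintegrable (F : G -> R[i]) :=
  mu.-integrable setT (EFin \o (fun x : borelType G => complex.Re (F x))) /\
  mu.-integrable setT (EFin \o (fun x : borelType G => complex.Im (F x))).

Lemma cintegrable_bounded (F : G -> R[i]) (M : R) : ccontinuous F ->
  (forall x, Normc.normc (F x) <= M) -> cintegrable F.
Proof.
move=> [cr ci] FM; split.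
- by apply: (integrable_borel _ M cr) => x; exact: le_trans (Re_le_normc _) (FM x).
- by apply: (integrable_borel _ M ci) => x; exact: le_trans (Im_le_normc _) (FM x).
Qed.

Let cint (F : G -> R[i]) : R[i] := cintegral mu (F : borelType G -> R[i]).

Lemma cintegral_shift (F : G -> R[i]) (M : R) (y : G) : ccontinuous F ->
  (forall x, Normc.normc (F x) <= M) -> cint (fun x => F (y + x)) = cint F.
Proof.
move=> [cr ci] FM; congr Complex.
- apply: (Rintegral_shift (fun x => complex.Re (F x)) M) => // x.
  exact: le_trans (Re_le_normc _) (FM x).
- apply: (Rintegral_shift (fun x => complex.Im (F x)) M) => // x.
  exact: le_trans (Im_le_normc _) (FM x).
Qed.

Lemma cintegrableD (F H : G -> R[i]) : cintegrable F -> cintegrable H ->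
  cintegrable (fun x => F x + H x).
Proof.
move=> [Fr Fi] [Hr Hi]; split.
- rewrite (_ : _ \o _ = (EFin \o (fun x : borelType G => complex.Re (F x))) \+
     (EFin \o (fun x : borelType G => complex.Re (H x))))%E; first exact: integrableD.
  by apply/funext => x /=; case: (F x) (H x) => [? ?] [].
- rewrite (_ : _ \o _ = (EFin \o (fun x : borelType G => complex.Im (F x))) \+
     (EFin \o (fun x : borelType G => complex.Im (H x))))%E; first exact: integrableD.
  by apply/funext => x /=; case: (F x) (H x) => [? ?] [].
Qed.

Lemma cintegralD (F H : G -> R[i]) : cintegrable F -> cintegrable H ->
  cint (fun x => F x + H x) = cint F + cint H.
Proof.
move=> [Fr Fi] [Hr Hi]; rewrite /cint /cintegral.
rewrite [RHS]/GRing.add /=; congr Complex.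
- rewrite -RintegralD//; congr fine; apply: eq_integral => x _.
  by case: (F x) (H x) => [? ?] [].
- rewrite -RintegralD//; congr fine; apply: eq_integral => x _.
  by case: (F x) (H x) => [? ?] [].
Qed.

Lemma integrable_EFinZl (a : R) (h : borelType G -> R) :
  mu.-integrable setT (EFin \o h) ->
  mu.-integrable setT (EFin \o (fun x => a * h x)).
Proof. exact: integrableZl. Qed.

Lemma cintegrableZ (c : R[i]) (F : G -> R[i]) :
  cintegrable F -> cintegrable (fun x => c * F x).
Proof.
case: c => a b [Fr Fi]; split.
- rewrite (_ : _ \o _ = (EFin \o (fun x : borelType G => a * complex.Re (F x))%R)
     \- (EFin \o (fun x : borelType G => b * complex.Im (F x))%R))%E.
    by apply: integrableB => //; exact: integrable_EFinZl.
  by apply/funext => x /=; case: (F x).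
- rewrite (_ : _ \o _ = (EFin \o (fun x : borelType G => a * complex.Im (F x))%R)
     \+ (EFin \o (fun x : borelType G => b * complex.Re (F x))%R))%E.
    by apply: integrableD => //; exact: integrable_EFinZl.
  by apply/funext => x /=; case: (F x).
Qed.

Lemma cintegralZ (c : R[i]) (F : G -> R[i]) : cintegrable F ->
  cint (fun x => c * F x) = c * cint F.
Proof.
case: c => a b [Fr Fi]; rewrite /cint /cintegral.
rewrite [RHS]/GRing.mul /=; congr Complex.
- rewrite -!RintegralZl// -RintegralB//; try exact: integrable_EFinZl.
  by congr fine; apply: eq_integral => x _; case: (F x).
- rewrite -!RintegralZl// -RintegralD//; try exact: integrable_EFinZl.
  by congr fine; apply: eq_integral => x _; case: (F x).
Qed.

Lemma cintegral_sum (I : Type) (s : seq I) (F : I -> G -> R[i]) :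
  (forall i, cintegrable (F i)) ->
  cintegrable (fun x => \sum_(i <- s) F i x) /\
  cint (fun x => \sum_(i <- s) F i x) = \sum_(i <- s) cint (F i).
Proof.
move=> iF; elim: s => [|i s [ih1 ih2]].
  have z0 : (fun x : G => \sum_(i <- [::]) F i x) = (fun=> 0).
    by apply/funext => x; rewrite big_nil.
  rewrite z0 big_nil; split; first by split; exact: integrable0.
  by rewrite /cint /cintegral /= /Rintegral integral0.
have -> : (fun x => \sum_(j <- i :: s) F j x) =
          (fun x => F i x + \sum_(j <- s) F j x).
  by apply/funext => x; rewrite big_cons.
by rewrite big_cons -ih2; split; [exact: cintegrableD|exact: cintegralD].
Qed.

(** Translating by y multiplies F by F y, but leaves its integral unchanged. *)
Lemma cintegral_morphism0 (F : G -> R[i]) (y : G) : ccontinuous F ->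
  (forall x, Normc.normc (F x) <= 1) -> (forall x z, F (x + z) = F x * F z) ->
  F y != 1 -> cint F = 0.
Proof.
move=> cF F1 FD Fy; have := cintegral_shift F 1 y cF F1.
rewrite (_ : (fun x => _) = (fun x => F y * F x)); last by apply/funext => x.
rewrite cintegralZ; last exact: cintegrable_bounded F1.
move=> /eqP; rewrite -subr_eq0 -{2}[cint F]mul1r -mulrBl mulf_eq0 subr_eq0.
by rewrite (negbTE Fy) => /eqP.
Qed.

Lemma cintegral1 : cint (fun=> 1) = 1.
Proof.
rewrite /cint /cintegral /=; congr Complex; rewrite /Rintegral.
  rewrite -[RHS]/(fine 1%E); congr fine.
  by rewrite integral_cst// mul1e; exact: probability_setT.
by rewrite integral0.
Qed.

Lemma ccontinuous_dual (g : dual R G) : ccontinuous g.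
Proof.
split=> x; apply/cvgrPdist_lt => e e0.
- have := @character_continuous _ _ g x => /cvgrPdist_lt /(_ e%:C%C).
  rewrite ltcR => /(_ e0); apply: filterS => y.
  move=> h; rewrite -ltcR; apply: le_lt_trans h.
  by apply: le_trans (normc_ge_Re _); case: (g x) (g y) => [? ?] [].
- have := @character_continuous _ _ g x => /cvgrPdist_lt /(_ e%:C%C).
  rewrite ltcR => /(_ e0); apply: filterS => y.
  rewrite [X in X < _]/Num.norm /= ltcR; apply: le_lt_trans.
  by apply: le_trans (Im_le_normc _); case: (g x) (g y) => [? ?] [].
Qed.

Lemma normc_dual (g : dual R G) (x : G) : Normc.normc (g x) = 1.
Proof. by have := character_norm1 g x; rewrite /Num.norm /= => -[]. Qed.

Lemma normc_conjc (z : R[i]) : Normc.normc (conjc z) = Normc.normc z.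
Proof. by case: z => x y /=; rewrite sqrrN. Qed.

Lemma dual_conjK (g : dual R G) (x : G) : g x * conjc (g x) = 1.
Proof. by rewrite -sqr_normc character_norm1 expr1n. Qed.

Lemma dual_ext (g h : dual R G) : (forall x, g x = h x) -> g = h.
Proof.
case: g h => g cg gD g1 [h ch hD h1] /= /funext gh.
by subst h; congr Character; exact: Prop_irrelevance.
Qed.

Lemma ccontinuous_dualM (g h : dual R G) :
  ccontinuous (fun x => g x * conjc (h x)).
Proof.
have [[gr gi] [hr hi]] := (ccontinuous_dual g, ccontinuous_dual h).
split=> x.
- rewrite (_ : (fun _ => _) = (fun x => complex.Re (g x) * complex.Re (h x) +
      complex.Im (g x) * complex.Im (h x))).
    by apply: cvgD; apply: cvgM; [exact: gr|exact: hr|exact: gi|exact: hi].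
  by apply/funext => y; case: (g y) (h y) => [a b] [a' b'] /=; rewrite mulrN opprK.
- rewrite (_ : (fun _ => _) = (fun x => complex.Im (g x) * complex.Re (h x) -
      complex.Re (g x) * complex.Im (h x))).
    by apply: cvgB; apply: cvgM; [exact: gi|exact: hr|exact: gr|exact: hi].
  apply/funext => y; case: (g y) (h y) => [a b] [a' b'] /=.
  by rewrite mulrN addrC.
Qed.

Lemma normc_dualM (g h : dual R G) (x : G) :
  Normc.normc (g x * conjc (h x)) <= 1.
Proof. by rewrite Normc.normcM normc_conjc !normc_dual mulr1. Qed.

(** For g <> h, the product of g and the conjugate of h is a nontrivial
character: as h has modulus 1, its value at y is 1 only if g y = h y. *)
Lemma fourier_dual (g h : dual R G) : fourier mu g h = (g == h)%:R.
Proof.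
have [<-|gh] := eqVneq g h.
  rewrite -[RHS]cintegral1; congr cintegral.
  by apply/funext => x; exact: dual_conjK.
have [y gy] : exists y, g y != h y.
  apply: contrapT => gh'; case/eqP: gh; apply: dual_ext => x.
  by apply: contrapT => gx; apply: gh'; exists x; apply/eqP.
apply: (cintegral_morphism0 (fun x => g x * conjc (h x)) y).
- exact: ccontinuous_dualM.
- exact: normc_dualM.
- by move=> x z; rewrite !characterD rmorphM mulrACA.
- apply: contra gy => /eqP gh1.
  by rewrite -[g y]mulr1 -(dual_conjK h y) mulrCA gh1 mulr1.
Qed.

Lemma fourier_sum (s : {fset dual R G}) (c : dual R G -> R[i]) (h : dual R G) :
  fourier mu (fun x => \sum_(g <- s) c g * g x) h = if h \in s then c h else 0.
Proof.
have iF g : cintegrable (fun x => c g * (g x * conjc (h x))).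
  by apply/cintegrableZ/(cintegrable_bounded _ 1) => [|x];
     [exact: ccontinuous_dualM|exact: normc_dualM].
rewrite /fourier (_ : (fun _ => _) =
    fun x : borelType G => \sum_(g <- s) c g * (g x * conjc (h x))); last first.
  apply/funext => x; rewrite mulr_suml.
  by apply: eq_bigr => g _; rewrite mulrA.
refine (etrans (cintegral_sum _ s _ iF).2 _).
have E g : cint (fun x => c g * (g x * conjc (h x))) = c g * (g == h)%:R.
  rewrite -fourier_dual.
  apply: cintegralZ; apply/(cintegrable_bounded _ 1) => [|x];
     [exact: ccontinuous_dualM|exact: normc_dualM].
under eq_bigr do rewrite E.
case: ifPn => hs.
  rewrite (bigD1_seq h) ?fset_uniq//= eqxx mulr1 big1 ?addr0// => g /negbTE->.
  by rewrite mulr0.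
rewrite big_seq big1// => g gs; case: eqP => [gh|]; last by rewrite mulr0.
by move: hs; rewrite -gh gs.
Qed.

(** The finite support is essential: a sum of infinitely many nonzero terms
over the whole dual is 0 by convention. *)
Lemma fourier_fsbig (k : dual R G -> R[i]) (s : {fset dual R G}) :
  (forall g, g \notin s -> k g = 0) ->
  forall h, fourier mu (fun x => \sum_(g \in [set: dual R G]) k g * g x) h = k h.
Proof.
move=> ks h.
rewrite (_ : (fun _ => _) = fun x => \sum_(g <- s) k g * g x).
  by rewrite fourier_sum; case: ifPn => // /ks.
apply/funext => x; apply: fsbigTE => g /ks->; exact: mul0r.
Qed.

Lemma trigpoly_fourier_support (f : G -> R[i]) : trigpoly f ->
  exists s : {fset dual R G}, forall g, g \notin s -> fourier mu f g = 0.
Proof.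
move=> [s [c fE]]; exists s => g gs.
by rewrite (_ : f = fun x => \sum_(g <- s) c g * g x) ?fourier_sum ?(negbTE gs)//;
   apply/funext.
Qed.
End HaarIntegral.

(** * The p-stable norm *)

Lemma normc_ge0 (R : realType) (z : R[i]) : 0 <= Normc.normc z.
Proof. by case: z => x y; exact: sqrtr_ge0. Qed.

(** The point x0 is there because the supremum over an empty set is -oo. *)
Lemma supnorm_ge0 (R : realType) (G : Type) (x0 : G) (F : G -> R[i]) :
  (0 <= supnorm F)%E.
Proof.
apply: le_trans (ereal_sup_ubound _); last by exists x0.
by rewrite lee_fin normc_ge0.
Qed.

Lemma supnormZ (R : realType) (G : Type) (x0 : G) (c : R) (F : G -> R[i]) :
  0 < c -> (c%:E * supnorm F <= supnorm (fun x => c%:C%C * F x)%R)%E.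
Proof.
move=> c0; rewrite -lee_pdivlMl//; apply: ge_ereal_sup => _ [x _ <-].
rewrite lee_pdivlMl// -EFinM; apply: ereal_sup_ubound; exists x => //.
by rewrite Normc.normcM /= expr0n /= addr0 sqrtr_sqr gtr0_norm.
Qed.

Lemma pstable_norm_ge0 d (Omega : measurableType d) (R : realType)
    (P : probability Omega R) (G : topologicalZmodType)
    (mu : probability (borelType G) R) (Z : dual R G -> Omega -> R[i])
    (f : G -> R[i]) : (0 <= pstable_norm P mu Z f)%E.
Proof. by apply: integral_ge0 => w _; exact: (supnorm_ge0 _ _ 0). Qed.

(** Only Fourier coefficients enter the p-stable norm, so that h is compared with
f through them rather than pointwise. *)
Lemma pstable_normZ d (Omega : measurableType d) (R : realType)
    (P : probability Omega R) (G : topologicalZmodType)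
    (mu : probability (borelType G) R) (Z : dual R G -> Omega -> R[i])
    (c : R) (f h : G -> R[i]) : 0 < c ->
  (forall g, fourier mu h g = c%:C%C * fourier mu f g) ->
  (c%:E * pstable_norm P mu Z f <= pstable_norm P mu Z h)%E.
Proof.
move=> c0 hf; apply: ge0_integral_scale_le => // w.
  exact: (supnorm_ge0 _ _ 0).
apply: le_trans (supnormZ _ _ 0 _ _ c0) _; rewrite le_eqVlt; apply/orP; left.
apply/eqP; congr supnorm; apply/funext => x; rewrite mulr_fsumr.
by apply: eq_fsbigr => g _; rewrite hf !mulrA [_ * Z g w]mulrC.
Qed.

(** * The lower bound *)

Theorem theorem2p3 (R : realType) (G : topologicalZmodType)
    (cG : compact [set: G]) (hG : hausdorff_space G)
    (mu : probability (borelType G) R) (haar_mu : is_haar mu)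
    (p : R) (p_gt1 : 1 < p) (p_le2 : p <= 2)
    (d : measure_display) (Omega : measurableType d) (P : probability Omega R)
    (Z : dual R G -> Omega -> R[i]) (iidZ : iid_pstable P p Z)
    (a : R) (a_gt0 : 0 < a) (contraction : contraction_principle P mu Z p a)
    (N : nat) (f : G -> R[i]) (fs : 'I_N -> G -> R[i])
    (tf : trigpoly f) (tfs : forall j : 'I_N, trigpoly (fs j))
    (dominated : forall g : dual R G,
       (\sum_(j < N) Normc.normc (fourier mu (fs j) g) `^ p) `^ p^-1
       <= Normc.normc (fourier mu f g)) :
  ((a^-1)%:E * (\sum_(j < N) pstable_norm P mu Z (fs j) `^ p) `^ p^-1
   <= pstable_norm P mu Z f)%E.
Proof.
have p_gt0 : 0 < p by exact: lt_trans p_gt1.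
have p_neq0 : p != 0 by rewrite gt_eqF.
have pV_neq0 : p^-1 != 0 by rewrite invr_eq0.
have [N0|] := posnP N.
  by subst N; rewrite big_ord0 poweR0r// mule0; exact: pstable_norm_ge0.
move=> N0; have N0' : 0 < N%:R :> R by rewrite ltr0n.
pose c : R := N%:R `^ p^-1; have c0 : 0 < c by exact: powR_gt0.
have cp : c `^ p = N%:R by rewrite -powRrM mulVf// powRr1// ltW.
(* The value of the multiplier of g on slot j; it is 0 when the coefficient of f
   vanishes, because division by 0 gives 0. *)
pose v g (j : 'I_N) := c%:C%C * (fourier mu (fs j) g / fourier mu f g).
have normc_v g j : Normc.normc (v g j) `^ p = N%:R *
    (Normc.normc (fourier mu (fs j) g) / Normc.normc (fourier mu f g)) `^ p.
  rewrite !Normc.normcM Normc.normcV /= expr0n /= addr0 sqrtr_sqr gtr0_norm//.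
  by rewrite powRM ?cp// ?ltW// divr_ge0// normc_ge0.
have dominatedX g : \sum_(j < N) Normc.normc (fourier mu (fs j) g) `^ p <=
    Normc.normc (fourier mu f g) `^ p.
  have S0 : 0 <= \sum_(j < N) Normc.normc (fourier mu (fs j) g) `^ p.
    by apply: sumr_ge0 => j _; exact: powR_ge0.
  rewrite -[leLHS]powRr1// -(mulVf p_neq0) powRrM.
  apply: (ge0_ler_powR (ltW p_gt0)); last exact: dominated.
  - by rewrite nnegrE powR_ge0.
  - by rewrite nnegrE normc_ge0.
have v_f g j : v g j * fourier mu f g = c%:C%C * fourier mu (fs j) g.
  rewrite /v -!mulrA; congr (_ * _).
  have [f0|f0] := eqVneq (fourier mu f g) 0; last by rewrite mulVf ?mulr1.
  (* Domination kills the coefficients of fs where that of f vanishes. *)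
  rewrite f0 !mulr0; apply/esym/Normc.eq0_normc.
  have := dominatedX g; rewrite f0 Normc.normc0 powR0// => S0.
  apply/eqP; have : Normc.normc (fourier mu (fs j) g) `^ p <= 0.
    apply: le_trans S0; rewrite (bigD1 j)//= lerDl.
    by apply: sumr_ge0 => i _; exact: powR_ge0.
  by rewrite le_eqVlt ltNge powR_ge0 orbF powR_eq0 => /andP[].
pose xi g t := step R N (v g) t.
have Lp_xi g : (Lp01_norm p (xi g) <= 1)%E.
  rewrite /Lp01_norm (integral_slots R N
      (fun j => (Normc.normc (v g j) `^ p)%:E)) => //; last 2 first.
  - by move=> j; rewrite lee_fin powR_ge0.
  - by move=> j t jt; rewrite /xi (step_slot _ _ _ _ _ N0 jt).
  rewrite -(poweR1r p^-1); apply: gt0_ler_poweR.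
  - by rewrite invr_ge0 ltW.
  - rewrite in_itv /= leey andbT; apply: sume_ge0 => j _.
    by rewrite mule_ge0// lee_fin ?invr_ge0 ?ltW// powR_ge0.
  - by rewrite in_itv /= leey andbT.
  under eq_bigr => j _ do
    rewrite normc_v -EFinM mulrA mulVf ?gt_eqF// mul1r powRM ?normc_ge0// ?invr_ge0 ?normc_ge0//.
  rewrite sumEFin lee_fin -mulr_suml.
  have [f0|f0] := eqVneq (Normc.normc (fourier mu f g)) 0.
    by rewrite f0 invr0 powR0// mulr0.
  have f0' : 0 < Normc.normc (fourier mu f g) by rewrite lt_neqAle eq_sym f0 normc_ge0.
  rewrite -powR_inv1 ?normc_ge0// powRAC powR_inv1 ?powR_ge0//.
  by rewrite ler_pdivrMr ?powR_gt0// mul1r.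
have sup_xi : (ereal_sup (range (fun g => Lp01_norm p (xi g))) <= 1)%E.
  by apply: ge_ereal_sup => _ [g _ <-].
have [sf sfP] := trigpoly_fourier_support R G mu haar_mu f tf.
pose H (j : 'I_N) := fun x : G =>
  \sum_(g \in [set: dual R G]) (v g j * fourier mu f g) * g x.
have H_slot (j : 'I_N) t : slot R N j t ->
    (fun x => \sum_(g \in [set: dual R G]) xi g t * fourier mu f g * g x) = H j.
  move=> jt; apply/funext => x; apply: eq_fsbigr => g _.
  by rewrite /xi (step_slot _ _ _ _ _ N0 jt).
have pn_H (j : 'I_N) :
    (c%:E * pstable_norm P mu Z (fs j) <= pstable_norm P mu Z (H j))%E.
  apply: pstable_normZ => // g.
  rewrite (fourier_fsbig R G mu haar_mu (fun k => v k j * fourier mu f k) sf) => //.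
  by move=> k ksf; rewrite sfP ?mulr0.
have pn0 u : (0 <= pstable_norm P mu Z u)%E by exact: pstable_norm_ge0.
have contr : ((\sum_(j < N) (N%:R^-1)%:E * pstable_norm P mu Z (H j) `^ p) `^ p^-1
    <= a%:E * ereal_sup (range (fun g => Lp01_norm p (xi g)))
       * pstable_norm P mu Z f)%E.
  have <- := integral_slots R N (fun j => pstable_norm P mu Z (H j) `^ p)%E
    (fun t => pstable_norm P mu Z (fun x : G =>
       \sum_(g \in [set: dual R G]) xi g t * fourier mu f g * g x)%R `^ p)%E N0.
  - apply: contraction => // [g|]; first exact: cmeasurable_step.
    by rewrite (le_lt_trans sup_xi)// ltry.
  - by move=> j; exact: poweR_ge0.
  - by move=> j t /H_slot ->.
rewrite lee_pdivrMl//; apply: (le_trans (le_trans _ contr)).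
- apply: gt0_ler_poweR.
  + by rewrite invr_ge0 ltW.
  + by rewrite in_itv /= leey andbT; apply: sume_ge0 => j _; exact: poweR_ge0.
  + rewrite in_itv /= leey andbT; apply: sume_ge0 => j _.
    by rewrite mule_ge0 ?poweR_ge0// lee_fin invr_ge0 ltW.
  (* The N of (N^(1/p))^p cancels the length 1/N of the slot. *)
  apply: lee_sum => j _; rewrite lee_pdivlMl// -cp -poweR_EFin -poweRM//; last first.
    by rewrite lee_fin ltW.
  apply: gt0_ler_poweR (pn_H j); first exact: ltW.
  + by rewrite in_itv /= leey andbT mule_ge0// lee_fin ltW.
  + by rewrite in_itv /= leey andbT.
- apply: lee_wpmul2r => //; rewrite -[leRHS]mule1.
  by apply: lee_wpmul2l => //; rewrite lee_fin ltW.
Qed.
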